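(* Let $d\ge 1$, let $c$ be an integral $\mathbb{R}^d$-configuration and assume that it has a non-trivial integral annihilator $f$. Then for every $\mathbf{u} \in \mathrm{supp}(f)$ it has an annihilator of the form $$(X^{\mathbf{v}_1} - 1) \cdots (X^{\mathbf{v}_m} - 1)$$ where each $\mathbf{v}_i\in\mathbb{R}^d$ is parallel to $\mathbf{u}_i - \mathbf{u}$ over $\mathbb{Q}$ for some $\mathbf{u}_i \in \mathrm{supp}(f) \setminus \{ \mathbf{u} \}$. Moreover, the vectors $\mathbf{v}_1,\ldots,\mathbf{v}_m$ can be chosen to be pairwise linearly independent over $\mathbb{Q}$.
   Context: An $\mathbb{R}^d$-configuration is a function $c\colon\mathbb{R}^d\to\mathbb{C}$ taking only finitely many values; a function $\mathbb{R}^d\to\mathbb{C}$ is integral if all its values are integers. An $\mathbb{R}^d$-polynomial is a finitely supported function $f\colon\mathbb{R}^d\to\mathbb{C}$, written $f=\sum_{\mathbf{u}\in\mathrm{supp}(f)} f_{\mathbf{u}}X^{\mathbf{u}}$, where $\mathrm{supp}(f)=\{\mathbf{u}\mid f(\mathbf{u})\ne 0\}$ and $1=X^{\mathbf{0}}$. The product of an $\mathbb{R}^d$-polynomial $f$ and a function $c\colon\mathbb{R}^d\to\mathbb{C}$ (in particular, another $\mathbb{R}^d$-polynomial) is $(fc)(\mathbf{u})=\sum_{\mathbf{v}\in\mathrm{supp}(f)} f(\mathbf{v})\,c(\mathbf{u}-\mathbf{v})$. An annihilator of $c$ is an $\mathbb{R}^d$-polynomial $f$ with $fc=0$; non-trivial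 means non-zero. Vectors $\mathbf{v},\mathbf{w}\in\mathbb{R}^d$ are parallel over $\mathbb{Q}$ if $q\mathbf{v}=p\mathbf{w}$ for some $p,q\in\mathbb{Z}\setminus\{0\}$. The empty product ($m=0$) is the polynomial $1$. *)

(* Defs.v *)
From HB Require Import structures.
From mathcomp Require Import all_boot all_order all_algebra.
From mathcomp Require Import mathcomp_extra boolp classical_sets functions.
From mathcomp Require Import cardinality fsbigop reals.
From mathcomp Require Import complex.

Set Implicit Arguments.
Unset Strict Implicit.
Unset Printing Implicit Defensive.

Import Order.TTheory GRing.Theory Num.Theory.

Local Open Scope classical_set_scope.
Local Open Scope ring_scope.

Section Defs.
Variables (R : realType) (d : nat).
Local Notation V := 'rV[R]_d.
Local Notation C := R[i].
Implicit Types (f c : V -> C) (u v w : V).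

Definition configuration c : Prop := finite_set (range c).

Definition integral c : Prop := forall u, exists z : int, c u = z%:~R.

Definition supp f : set V := [set u | f u != 0].

Definition polynomial f : Prop := finite_set (supp f).

(* The sum is finite when f is a polynomial; otherwise it has the default
   value 0 wherever infinitely many of its terms are nonzero. *)
Definition pmul f c : V -> C :=
  fun u => \sum_(v \in supp f) f v * c (u - v).

Definition Xpow v : V -> C := fun u => (u == v)%:R.

Definition pone : V -> C := Xpow 0.

Definition annihilator c f : Prop := polynomial f /\ pmul f c = cst 0.

Definition Qparallel v w : Prop :=
  exists p q : int, [/\ p != 0, q != 0 & v *~ q = w *~ p].

Definition Qindep2 v w : Prop :=
  forall a b : rat, ratr a *: v + ratr b *: w = 0 -> a = 0 /\ b = 0.

Definition diff_prod (m : nat) (v : 'I_m -> V) : V -> C :=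
  \big[pmul/pone]_(i < m) (Xpow (v i) \- pone).

End Defs.

(* Main.v *)
Require Import Defs.
From HB Require Import structures.
From mathcomp Require Import all_boot all_order all_algebra.
From mathcomp Require Import mathcomp_extra boolp classical_sets functions.
From mathcomp Require Import cardinality fsbigop reals.
From mathcomp Require Import complex.
From mathcomp Require Import finfield zify ring.

(* Since f^p = f(X^p) mod p for a prime p, f(X^p) c vanishes mod p; being
   bounded independently of p it is 0 when p is large. Hence f(X^k) annihilates
   c for all k without small prime factors, in particular for k = 1 + r j with r
   a suitable factorial. After translating by k u this reads
     f_u c = - sum_(v != u) f_v X^(v - u) X^(j r (v - u)) c.
   Average over j < N and apply the product of all X^(r (v - u)) - 1: each
   average telescopes under its own factor, so the right-hand side is O(1/N),
   and the product annihilates c. Q-parallel factors are merged by passing to a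
   common multiple w: a bounded function killed by (X^w - 1)^2 grows linearly
   along w unless it is already killed by X^w - 1. *)

Set Implicit Arguments.
Unset Strict Implicit.
Unset Printing Implicit Defensive.

Import Order.TTheory GRing.Theory Num.Theory.

Local Open Scope classical_set_scope.
Local Open Scope ring_scope.

(** * Binomial theorem and Frobenius identity for commuting additive maps *)

Lemma mulrzfctE (U : Type) (K : zmodType) (f : U -> K) (z : int) :
  f *~ z = (fun x => f x *~ z).
Proof.
case: z => n; first exact: natmulfctE.
by apply/funext => x; rewrite NegzE !mulrNz fctE -!pmulrn natmulfctE.
Qed.

Lemma iter_addD (M : zmodType) (A B : {additive M -> M})
    (AB : forall x, A (B x) = B (A x)) n x :
  iter n (fun y => A y + B y) x =
  \sum_(i < n.+1) iter (n - i) A (iter i B x) *+ 'C(n, i).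
Proof.
have comm k y : B (iter k A y) = iter k A (B y).
  by elim: k => //= k <-; rewrite AB.
elim: n => [|n IHn]; rewrite big_ord_recl /= ?big_ord0 ?addr0 //.
rewrite {}IHn !raddf_sum /= big_ord_recl !big_ord_recr /= !binn !subnn.
rewrite !subn0 !bin0 -addrA; congr (_ + _); rewrite addrA -big_split /=.
congr (_ + _); apply: eq_bigr => i _; rewrite !raddfMn /= /bump add1n add0n.
by rewrite comm -[A (iter _ A _)]iterS -subSn // subSS -mulrnDr binS addnC.
Qed.

(** The inner binomial coefficients are divisible by [p] and so vanish on [M]; only the two extreme
    terms survive. *)
Lemma iter_prime_addD (M : zmodType) (p : nat) (pr_p : prime p)
    (char_p : forall x : M, x *+ p = 0) (A B : {additive M -> M})
    (AB : forall x, A (B x) = B (A x)) x :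
  iter p (fun y => A y + B y) x = iter p A x + iter p B x.
Proof.
rewrite iter_addD //; case: p pr_p char_p => // p pr_p char_p.
rewrite big_ord_recl big_ord_recr /= /bump !add1n !subnn binn bin0 !mulr1n.
rewrite big1 ?add0r // => i _.
have /dvdnP[k ->] : (p.+1 %| 'C(p.+1, 1 + i))%N.
  by apply: prime_dvd_bin => //; rewrite add1n /= ltnS ltn_ord.
by rewrite mulrnA char_p.
Qed.

(** * Polynomials as convolution operators, and dilation of their exponents *)

Section Convolution.
Variables (V : zmodType) (A : comPzRingType).

Definition wshift (a : A) (w : V) (g : V -> A) : V -> A :=
  fun x => a * g (x - w).

Lemma wshift_is_additive a w : zmod_morphism (wshift a w).
Proof. by move=> g h; apply/funext => x; rewrite /wshift /= mulrBr. Qed.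

HB.instance Definition _ a w :=
  GRing.isZmodMorphism.Build (V -> A) (V -> A) (wshift a w)
    (wshift_is_additive a w).

(** The action of the polynomial with terms [a i] X^([w i]). Keeping an indexed family of terms lets
    the exponents be dilated without touching the coefficients, even if some exponents come to
    coincide. *)
Definition conv (I : Type) (a : I -> A) (w : I -> V) (s : seq I)
    (g : V -> A) : V -> A :=
  \sum_(i <- s) wshift (a i) (w i) g.

Lemma conv_is_additive I a w s : zmod_morphism (@conv I a w s).
Proof.
by move=> g h; rewrite /conv -sumrB; apply: eq_bigr => i _; exact: raddfB.
Qed.

HB.instance Definition _ I a w s :=
  GRing.isZmodMorphism.Build (V -> A) (V -> A) (@conv I a w s)
    (@conv_is_additive I a w s).

Lemma convE I (a : I -> A) w s g x :
  conv a w s g x = \sum_(i <- s) a i * g (x - w i).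
Proof. by rewrite /conv fct_sumE. Qed.

Lemma wshiftC a b v w g :
  wshift a v (wshift b w g) = wshift b w (wshift a v g).
Proof. by apply/funext => x; rewrite /wshift mulrCA addrAC. Qed.

Lemma wshift_conv I (a : I -> A) w s b v g :
  wshift b v (conv a w s g) = conv a w s (wshift b v g).
Proof. by rewrite /conv raddf_sum; apply: eq_bigr => i _; exact: wshiftC. Qed.

Lemma iter_wshift a w n g : iter n (wshift a w) g = wshift (a ^+ n) (w *+ n) g.
Proof.
elim: n => [|n /= ->]; apply/funext => x; rewrite /wshift ?subr0 ?mul1r //=.
by rewrite mulrA exprS mulrS opprD addrA.
Qed.

End Convolution.

(** This is f^p = f(X^p) over ['F_p]: monomials are split off one at a time, and Fermat's little
    theorem gives back the coefficients. *)
Lemma conv_frobenius (V : zmodType) (I : Type) (p : nat) (pr_p : prime p)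
    (a : I -> 'F_p) (w : I -> V) (s : seq I) (g : V -> 'F_p) :
  iter p (conv a w s) g = conv a (fun i => w i *+ p) s g.
Proof.
have char_p (h : V -> 'F_p) : h *+ p = 0.
  by apply/funext => x; rewrite natmulfctE mulrn_pchar ?pchar_Fp.
elim: s => [|i s IHs].
  (* The empty sum is the zero operator; its [p]-th iterate is zero because [p] is positive. *)
  rewrite /conv !big_nil; case: p pr_p {char_p} a g => // p _ a g.
  by rewrite iterS big_nil.
rewrite (@eq_iter _ _ (fun h => wshift (a i) (w i) h + conv a w s h)); last first.
  by move=> h; rewrite /conv big_cons.
rewrite iter_prime_addD //; last exact: wshift_conv.
have fermat (b : 'F_p) : b ^+ p = b.
  by have := expf_card b; rewrite card_Fp.
rewrite IHs iter_wshift fermat.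
by rewrite /conv big_cons.
Qed.

Lemma conv_dilate_prime (V : zmodType) (I : Type) (s : seq I) (a : I -> int)
    (w : I -> V) (g : V -> int) (M : int) (p : nat) (pr_p : prime p)
    (g_le : forall x, `|g x| <= M) (p_gt : (\sum_(i <- s) `|a i|) * M < p%:Z) :
  conv a w s g = 0 -> conv a (fun i => w i *+ p) s g = 0.
Proof.
move=> ag0; apply/funext => x; rewrite convE /=.
set y := \sum_(i <- s) _.
have y_lt : `|y| < p%:Z.
  apply: le_lt_trans p_gt; rewrite mulr_suml; apply: le_trans (ler_norm_sum _ _ _) _.
  by apply: ler_sum => i _; rewrite normrM ler_wpM2l.
have conv_modp w' : conv (fun i => (a i)%:~R) w' s (fun x => (g x)%:~R : 'F_p)
    = fun x => (conv a w' s g x)%:~R.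
  apply/funext => z; rewrite !convE rmorph_sum; apply: eq_bigr => i _.
  by rewrite rmorphM.
have : conv (fun i => (a i)%:~R : 'F_p) (fun i => w i *+ p) s
    (fun x => (g x)%:~R) = 0.
  rewrite -conv_frobenius //.
  (* As [p] is positive, the iterate has an innermost application, which already gives 0 mod [p]. *)
  case: p pr_p {p_gt y y_lt} conv_modp => // p pr_p conv_modp.
  have z0 : (fun x : V => ((0 : V -> int) x)%:~R) = 0 :> (V -> 'F_p.+1).
    by apply/funext.
  rewrite iterSr conv_modp ag0 {}z0.
  exact/iter_fix/raddf0.
rewrite conv_modp => /(congr1 (@^~ x)) /= /eqP.
rewrite convE -/y -(dvdz_pcharf (pchar_Fp pr_p)) => p_dvd_y.
apply/eqP; apply: contraTT p_dvd_y => y_neq0.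
by rewrite dvdzE gtnNdvd // ?absz_gt0 // -ltz_nat abszE.
Qed.

(** Prime factors of [k] are treated one by one. Dilation leaves the coefficients unchanged, so the
    same bound on primes serves at every stage. *)
Lemma conv_dilate (V : zmodType) (I : Type) (s : seq I) (a : I -> int)
    (w : I -> V) (g : V -> int) (M : int) (g_le : forall x, `|g x| <= M)
    (k : nat) (k_gt0 : (0 < k)%N)
    (k_rough : forall p, prime p -> (p %| k)%N ->
                         (\sum_(i <- s) `|a i|) * M < p%:Z) :
  conv a w s g = 0 -> conv a (fun i => w i *+ k) s g = 0.
Proof.
move=> ag0; elim/ltn_ind: k k_gt0 k_rough => k IHk k_gt0 k_rough.
have [k_le1|k_gt1] := leqP k 1.
  by have -> : k = 1%N by lia.
have pr_p := pdiv_prime k_gt1; have p_dvd := pdiv_dvd k.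
have -> : (fun i => w i *+ k) = (fun i => w i *+ (k %/ pdiv k) *+ pdiv k).
  by apply/funext => i; rewrite -mulrnA divnK.
apply: (conv_dilate_prime pr_p g_le (k_rough _ pr_p p_dvd)).
apply: IHk => [||p pr_p' p_dvd'].
- by rewrite ltn_Pdiv // prime_gt1.
- by rewrite divn_gt0 ?prime_gt0 // dvdn_leq.
- by apply: k_rough => //; apply: dvdn_trans p_dvd' (dvdn_div p_dvd).
Qed.

(** * Difference operators on bounded integer functions *)

Section Differences.
Variables (V A : zmodType).
Implicit Types (v w : V) (g : V -> A) (l : seq V).

(** The action of X^v - 1; [Deltas] below is the action of a product of such factors. *)
Definition Delta v g : V -> A := fun x => g (x - v) - g x.

Lemma Delta_is_additive v : zmod_morphism (Delta v).
Proof.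
move=> g h; apply/funext => x; rewrite /Delta !fctE /=.
by rewrite opprD addrACA -opprD.
Qed.

HB.instance Definition _ v :=
  GRing.isZmodMorphism.Build (V -> A) (V -> A) (Delta v) (Delta_is_additive v).

Definition Deltas l g : V -> A := foldr Delta g l.

Lemma Deltas_is_additive l : zmod_morphism (Deltas l).
Proof. by move=> g h; elim: l => //= v l ->; rewrite raddfB. Qed.

HB.instance Definition _ l :=
  GRing.isZmodMorphism.Build (V -> A) (V -> A) (Deltas l)
    (Deltas_is_additive l).

Lemma DeltaC v w g : Delta v (Delta w g) = Delta w (Delta v g).
Proof.
by apply/funext => x; rewrite /Delta [x - v - w]addrAC !opprD addrACA.
Qed.

Lemma DeltaCs v l g : Delta v (Deltas l g) = Deltas l (Delta v g).
Proof. by elim: l => //= w l <-; rewrite DeltaC. Qed.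

Lemma Deltas_pull l1 v l2 g :
  Deltas (l1 ++ v :: l2) g = Delta v (Deltas (l1 ++ l2) g).
Proof. by rewrite /Deltas !foldr_cat /= -/(Deltas l1 _) -DeltaCs. Qed.

Lemma Delta_eq0P v g : Delta v g = 0 <-> forall x, g (x - v) = g x.
Proof.
split=> [/funeqP g0 x|gv]; first by apply/eqP; rewrite -subr_eq0; apply/eqP/g0.
by apply/funext => x; rewrite /Delta gv subrr.
Qed.

(** Periods are closed under integer multiples; equivalently, X^v - 1 divides X^(qv) - 1. *)
Lemma Delta_mulz v g (q : int) : Delta v g = 0 -> Delta (v *~ q) g = 0.
Proof.
move=> /Delta_eq0P gv; apply/Delta_eq0P.
have gvn n x : g (x - v *+ n) = g x.
  by elim: n x => [|n IHn] x; rewrite ?subr0 // mulrS opprD addrA IHn.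
case: q => n x; first exact: gvn.
by rewrite NegzE mulrNz opprK -pmulrn -(gvn n.+1 (x + _)) addrK.
Qed.

End Differences.

Lemma Deltas_le (V : zmodType) (l : seq V) (g : V -> int) (M : int)
    (g_le : forall x, `|g x| <= M) x :
  `|Deltas l g x| <= 2 ^+ size l * M.
Proof.
elim: l x => [|v l IHl] x /=; first by rewrite mul1r.
rewrite /Delta (le_trans (ler_normB _ _)) // exprS.
by have := IHl (x - v); have := IHl x; lia.
Qed.

Lemma int_bounded_eq0 (a K : int) : (forall N : nat, `|a *+ N| <= K) -> a = 0.
Proof.
move=> aK; apply/eqP; apply: contraT => a_neq0.
have := aK (`|K|.+1)%N; rewrite -mulr_natr normrM; nia.
Qed.

Lemma Delta_sqr_eq0 (V : zmodType) (v : V) (g : V -> int) (M : int)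
    (g_le : forall x, `|g x| <= M) :
  Delta v (Delta v g) = 0 -> Delta v g = 0.
Proof.
move=> /Delta_eq0P g_lin; apply/funext => x; apply: (@int_bounded_eq0 _ (M + M)).
move=> N.
(* [Delta v g] has period [v], so [g] runs through an arithmetic progression along [v]; boundedness
   forces its step to be 0. *)
have -> : Delta v g x *+ N = g (x - v *+ N) - g x.
  elim: N => [|N IHN]; first by rewrite subr0 subrr.
  have {}g_lin : Delta v g (x - v *+ N) = Delta v g x.
    by elim: (N) => [|n IHn]; rewrite ?subr0 // mulrSr opprD addrA g_lin.
  by rewrite mulrS IHN -g_lin /Delta mulrSr opprD [in RHS]addrA addrA subrK.
have := g_le (x - v *+ N); have := g_le x; lia.
Qed.

(* Averaging the equation over [j < N] expresses [a0 * g] as a combination of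
   Cesaro means along the directions [W i]; [Delta (W i)] telescopes such a mean
   to size O(1/N). *)
Lemma Deltas_eq0_of_progressions (V : zmodType) (I : eqType) (s : seq I)
    (a0 : int) (a : I -> int) (w W : I -> V) (g : V -> int) (M : int)
    (g_le : forall x, `|g x| <= M) (a0_neq0 : a0 != 0)
    (g_eq : forall (j : nat) x,
       a0 * g x + \sum_(i <- s) a i * g (x - (w i + W i *+ j)) = 0) :
  Deltas [seq W i | i <- s] g = 0.
Proof.
set l := [seq W i | i <- s]; apply/funext => x.
(* [N] times the Cesaro mean, so that everything stays in the integers; dividing by [N] is replaced
   by [int_bounded_eq0] at the end. *)
pose S N i : V -> int := \sum_(0 <= j < N) (fun y => g (y - (w i + W i *+ j))).
have S_eq N : g *~ a0 *+ N = - \sum_(i <- s) S N i *~ a i.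
  apply/eqP; rewrite -addr_eq0; apply/eqP/funext => y.
  rewrite !(fctE, natmulfctE, mulrzfctE) fct_sumE.
  under eq_bigr do rewrite mulrzfctE /S fct_sumE.
  have -> : g y *~ a0 *+ N = \sum_(0 <= j < N) a0 * g y.
    by rewrite sumr_const_nat subn0 mulrzz mulrC.
  under eq_bigr do rewrite mulrzz mulrC mulr_sumr.
  by rewrite exchange_big -big_split; apply: big1 => j _; exact: g_eq.
have S_le N i : i \in s -> `|Deltas l (S N i) x| <= 2 ^+ size l * M.
  move=> si; have : W i \in l by apply: map_f.
  (* Apply [Delta (W i)] first: it telescopes the sum to a function bounded by [M + M]. Each of the
     other [size l - 1] differences at most doubles this, so the bound is independent of [N]. *)
  case/splitPr => l1 l2; rewrite Deltas_pull DeltaCs.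
  apply: le_trans (Deltas_le _ (M := M + M) _ _) _ => [y|]; last first.
    by rewrite !size_cat /= addnS exprS; lia.
  have -> : Delta (W i) (S N i) y = g (y - (w i + W i *+ N)) - g (y - w i).
    rewrite /Delta /S !fct_sumE -sumrB.
    have -> : y - w i = y - (w i + W i *+ 0) by rewrite addr0.
    rewrite -(telescope_sumr (fun j => g (y - (w i + W i *+ j)))) //=.
    apply: eq_bigr => j _; congr (g _ - _).
    by rewrite mulrS !opprD !addrA [_ - _ - w i]addrAC.
  have := g_le (y - (w i + W i *+ N)); have := g_le (y - w i); lia.
suff : a0 * Deltas l g x = 0 by move/eqP; rewrite mulf_eq0 (negPf a0_neq0) => /eqP.
apply: (@int_bounded_eq0 _ (\sum_(i <- s) `|a i| * (2 ^+ size l * M))) => N.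
have := congr1 (fun h => Deltas l h x) (S_eq N).
rewrite raddfN raddf_sum !(raddfMn, raddfMz) !(natmulfctE, mulrzfctE, fctE) /=.
rewrite fct_sumE mulrzz mulrC => ->; rewrite normrN.
apply: le_trans (ler_norm_sum _ _ _) _.
rewrite [leLHS]big_seq [leRHS]big_seq; apply: ler_sum => i si.
by rewrite raddfMz mulrzfctE mulrzz normrM mulrC ler_wpM2l // S_le.
Qed.

(** * Parallelism over the rationals and merging of parallel factors *)

Section Parallel.
Variables (R : realType) (d : nat).
Implicit Types (u v w : 'rV[R]_d) (l : seq 'rV[R]_d).

Lemma Qparallel_sym v w : Qparallel v w -> Qparallel w v.
Proof. by move=> [p [q [p0 q0 E]]]; exists q, p. Qed.

Lemma Qparallel_trans u v w : Qparallel u v -> Qparallel v w -> Qparallel u w.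
Proof.
move=> [p [q [p0 q0 uv]]] [p' [q' [p'0 q'0 vw]]].
exists (p * p'), (q * q'); split; rewrite ?mulf_neq0 //.
by rewrite mulrzA uv mulrzAC vw -mulrzA mulrC.
Qed.

Lemma Qparallel_mulz v (q : int) : q != 0 -> Qparallel (v *~ q) v.
Proof. by move=> q0; exists q, 1; rewrite mulr1z. Qed.

Lemma Qindep2_sym v w : Qindep2 v w -> Qindep2 w v.
Proof. by move=> vw a b; rewrite addrC => /vw[]. Qed.

Lemma Qindep2_nparallel v w :
  v != 0 -> w != 0 -> ~ Qparallel v w -> Qindep2 v w.
Proof.
move=> v0 w0 vw a b ab0.
have [a0|a0] := eqVneq a 0; have [b0|b0] := eqVneq b 0; first by [].
- move/eqP: ab0; rewrite a0 rmorph0 scale0r add0r scaler_eq0 (negPf w0) orbF.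
  by rewrite fmorph_eq0 => /eqP.
- move/eqP: ab0; rewrite b0 rmorph0 scale0r addr0 scaler_eq0 (negPf v0) orbF.
  by rewrite fmorph_eq0 => /eqP.
(* The coefficients come from clearing denominators in a v = - b w. *)
case: vw; exists (- (numq b * denq a)), (numq a * denq b).
rewrite oppr_eq0 !mulf_neq0 ?numq_eq0 ?denq_neq0 //; split=> //.
have ratrM c : (numq c)%:~R = ratr c * (denq c)%:~R :> R.
  by rewrite /ratr mulfVK // intr_eq0 denq_neq0.
have abE : ratr a *: v = - (ratr b *: w) by apply/eqP; rewrite -addr_eq0 ab0.
rewrite -!scaler_int rmorphN !rmorphM /= !ratrM -mulrA mulrC -scalerA abE.
by rewrite scalerN scalerA scaleNr; congr (- (_ *: _)); ring.
Qed.

(** Induction on [l], using the hypothesis for [Delta s g], which is bounded by [M + M]. The head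
    [s] either joins the new list or is merged with the entry [t] parallel to it. *)
Lemma merge_parallel l (g : 'rV[R]_d -> int) (M : int)
    (g_le : forall x, `|g x| <= M) (l_neq0 : 0 \notin l) :
  Deltas l g = 0 ->
  exists l', [/\ Deltas l' g = 0,
    forall v, v \in l' -> v != 0 /\ exists2 t, t \in l & Qparallel v t &
    pairwise (fun v w => ~~ `[< Qparallel v w >]) l'].
Proof.
elim: l g M g_le l_neq0 => [|s l IHl] g M g_le /=; first by move=> _ ?; exists [::].
rewrite inE negb_or eq_sym => /andP[s_neq0 l_neq0]; rewrite DeltaCs => lg0.
have [|l' [l'g0 l'l l'np]] := IHl _ (M + M) _ l_neq0 lg0.
  by move=> x; rewrite (le_trans (ler_normB _ _)) ?lerD.
case: (boolP (has (fun t => `[< Qparallel s t >]) l')); last first.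
  move=> /hasPn s_np; exists (s :: l'); split=> [|v|].
  - by rewrite /= DeltaCs.
  - rewrite inE => /predU1P[->|/l'l[v0 [t tl vt]]].
      split=> //; exists s; rewrite ?inE ?eqxx //.
      by rewrite -[s]mulr1z; exact: Qparallel_mulz.
    by split=> //; exists t => //; rewrite inE tl orbT.
  - by rewrite /= l'np andbT; apply/allP.
move=> /hasP[t tl' /asboolP st].
case/splitPr: tl' l'g0 l'l l'np => l1 l2 l'g0 l'l l'np.
case: (st) => p [q [p0 q0 stE]].
(* The common multiple w = s q = t p replaces both [s] and [t]. Since X^s - 1 and X^t - 1 both
   divide X^w - 1, the factor X^w - 1 taken twice annihilates, and [Delta_sqr_eq0] reduces it to
   one. *)
exists (s *~ q :: l1 ++ l2); split=> [|v|].
- apply: (@Delta_sqr_eq0 _ _ _ (2 ^+ size (l1 ++ l2) * M)).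
    exact: Deltas_le.
  apply: Delta_mulz; rewrite DeltaC stE; apply: Delta_mulz.
  by rewrite DeltaC -Deltas_pull DeltaCs.
- rewrite inE => /predU1P[->|vl].
    split; last by exists s; [rewrite inE eqxx | exact: Qparallel_mulz].
    by rewrite -scaler_int scaler_eq0 intr_eq0 negb_or q0.
  have /l'l[v0 [t' t'l vt']] : v \in l1 ++ t :: l2.
    by move: vl; rewrite !mem_cat inE => /orP[->//|->]; rewrite !orbT.
  by split=> //; exists t' => //; rewrite inE t'l orbT.
(* Being parallel to [t], the multiple w inherits from [t] non-parallelism to the other entries. *)
have w_np v : ~~ `[< Qparallel t v >] -> ~~ `[< Qparallel (s *~ q) v >].
  apply: contra => /asboolP wv; apply/asboolP; apply: Qparallel_trans wv.
  apply: Qparallel_trans (Qparallel_sym st) _.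
  by apply/Qparallel_sym/Qparallel_mulz.
move: l'np; rewrite /= !pairwise_cat /= allrel_consr all_cat.
move=> /and3P[/andP[l1t ->] -> /andP[tl2 ->]]; rewrite !andbT.
apply/andP; split; apply/allP => v vl; apply: w_np.
  move/allP: l1t => /(_ v vl); apply: contra => /asboolP tv.
  by apply/asboolP/Qparallel_sym.
exact: (allP tl2).
Qed.

End Parallel.

(** * From products of polynomials to difference operators *)

Section Pmul.
Variables (R : realType) (d : nat).
Local Notation V := 'rV[R]_d.
Local Notation pone := (@Defs.pone R d).
Implicit Types (f g c : V -> R[i]) (v w : V) (l s : seq V).

Lemma polynomialP f :
  Defs.polynomial f <-> exists2 s, uniq s & forall v, f v != 0 -> v \in s.
Proof.
split=> [/finite_seqP[s fE]|[s _ fs]].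
  exists (undup s); rewrite ?undup_uniq // => v fv.
  by rewrite mem_undup; have : supp f v by []; rewrite fE.
by apply: (sub_finite_set (B := [set` s])) => //; exact: finite_seq.
Qed.

(** Padding the support with zero terms allows products to be compared over one common list. *)
Lemma pmul_seq f c s x : uniq s -> (forall v, f v != 0 -> v \in s) ->
  pmul f c x = \sum_(v <- s) f v * c (x - v).
Proof.
move=> s_uniq fs; apply: fsbig_fwiden => // v /= [_].
by rewrite /supp /= => /negP; rewrite negbK => /eqP ->; rewrite mul0r.
Qed.

Lemma polynomial_pone : Defs.polynomial pone.
Proof.
apply/polynomialP; exists [:: 0] => // v; rewrite /Defs.pone /Xpow inE.
by case: (v == 0); rewrite // eqxx.
Qed.

Lemma pmul_pone c : pmul pone c = c.
Proof.
apply/funext => x; rewrite (@pmul_seq _ _ [:: 0]) // => [|v].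
  by rewrite big_seq1 /Defs.pone /Xpow eqxx mul1r subr0.
by rewrite /Defs.pone /Xpow inE; case: (v == 0); rewrite // eqxx.
Qed.

Lemma pmul_diff v c : pmul (@Xpow R d v \- pone) c = Delta v c.
Proof.
(* For v = 0 the polynomial is zero and its support empty; the list [[:: v; 0]] would then repeat an
   entry. *)
apply/funext => x; have [->|v0] := eqVneq v 0.
  rewrite (@pmul_seq _ _ [::]) // ?big_nil; first by rewrite /Delta subr0 subrr.
  by move=> w; rewrite /Defs.pone /Xpow /= subrr eqxx.
rewrite (@pmul_seq _ _ [:: v; 0]) /= ?inE ?v0 // => [|w].
  rewrite big_cons big_seq1 /Defs.pone /Xpow /= !eqxx (negPf v0) [0 == v]eq_sym.
  by rewrite (negPf v0) subr0 sub0r mul1r mulN1r subr0.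
rewrite /Defs.pone /Xpow /= !inE; case: (w == v); case: (w == 0) => //=.
by rewrite subrr eqxx.
Qed.

Lemma Delta_supp v f s : (forall w, f w != 0 -> w \in s) ->
  forall w, Delta v f w != 0 -> w \in undup (s ++ map (+%R^~ v) s).
Proof.
move=> fs w; rewrite mem_undup mem_cat /Delta; apply: contraNT.
rewrite negb_or => /andP[ws wvs].
have -> : f w = 0 by apply/eqP; apply: contraNT ws => /fs.
have -> : f (w - v) = 0.
  apply/eqP; apply: contraNT wvs => /fs wv.
  by apply/mapP; exists (w - v); rewrite ?subrK.
by rewrite subrr.
Qed.

Lemma polynomial_Delta v f : Defs.polynomial f -> Defs.polynomial (Delta v f).
Proof.
move=> /polynomialP[s _ fs]; apply/polynomialP.
by exists (undup (s ++ map (+%R^~ v) s)); [exact: undup_uniq|exact: Delta_supp].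
Qed.

(** Associativity with X^v - 1 as first factor: translating a product amounts to translating [f]. *)
Lemma pmul_Delta v f c :
  Defs.polynomial f -> pmul (Delta v f) c = Delta v (pmul f c).
Proof.
move=> /polynomialP[s s_uniq fs]; apply/funext => x.
set t := undup (s ++ map (+%R^~ v) s).
have ft w : f w != 0 -> w \in t by move/fs; rewrite mem_undup mem_cat => ->.
have fvt w : f (w - v) != 0 -> w \in t.
  move=> /fs wv; rewrite mem_undup mem_cat; apply/orP; right.
  by apply/mapP; exists (w - v); rewrite ?subrK.
rewrite (@pmul_seq _ _ t) ?undup_uniq //; last exact: Delta_supp.
rewrite {2}/Delta [pmul f c x](@pmul_seq _ _ t) ?undup_uniq //.
have -> : pmul f c (x - v) = pmul (fun w => f (w - v)) c x.
  rewrite [RHS](@pmul_seq _ _ (map (+%R^~ v) s)); last 2 first.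
  - by rewrite map_inj_uniq //; exact: addIr.
  - by move=> w /fs wv; apply/mapP; exists (w - v); rewrite ?subrK.
  rewrite (@pmul_seq _ _ s) // big_map; apply: eq_bigr => w _.
  by rewrite addrK opprD addrA addrAC.
rewrite (@pmul_seq _ _ t) ?undup_uniq // -sumrB; apply: eq_bigr => w _.
by rewrite /Delta mulrBl.
Qed.

Lemma annihilator_diff_prod l c (cI : V -> int) :
    c = (fun x => (cI x)%:~R) -> Deltas l cI = 0 ->
  annihilator c (diff_prod (fun i : 'I_(size l) => l`_i)).
Proof.
move=> cE lc0; have -> : diff_prod (fun i : 'I_(size l) => l`_i) = Deltas l pone.
  rewrite /diff_prod -(big_mkord xpredT (fun i => @Xpow R d l`_i \- pone)).
  rewrite -(big_nth 0 xpredT (fun v : V => @Xpow R d v \- pone)).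
  (* Unfolded, the iterated product is a right fold that matches [Deltas] factor by factor. *)
  by rewrite unlock; elim: (l) => //= v l' ->; exact: pmul_diff.
have [poly_l pmul_l] : Defs.polynomial (Deltas l pone) /\
    pmul (Deltas l pone) c = Deltas l c.
  elim: (l) => [|v l' [pol pml]] /=.
    by split; [exact: polynomial_pone | exact: pmul_pone].
  by split; [exact: polynomial_Delta | rewrite pmul_Delta // pml].
split=> //; rewrite {}pmul_l; apply/funext => x.
have -> : Deltas l c = fun y => (Deltas l cI y)%:~R.
  rewrite cE; elim: (l) => //= v l' ->; apply/funext => y.
  by rewrite /Delta rmorphB.
by rewrite lc0.
Qed.

End Pmul.

(** * Passage to integer values and the final assembly *)

Lemma integral_lift (R : realType) (d : nat) (c : 'rV[R]_d -> R[i]) :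
  integral c -> exists cI : 'rV[R]_d -> int, c = (fun x => (cI x)%:~R).
Proof. by move=> /choice[cI cE]; exists cI; apply/funext. Qed.

Lemma configuration_bounded (R : realType) (d : nat) (cI : 'rV[R]_d -> int) :
  configuration (fun x => (cI x)%:~R : R[i]) -> exists M, forall x, `|cI x| <= M.
Proof.
move=> c_fin.
have /finite_seqP[s sE] : finite_set (range cI).
  apply: (@sub_finite_set _ _ (intr @^-1` range (fun x => (cI x)%:~R : R[i]))).
    by move=> _ [x _ <-]; exists x.
  by apply: finite_preimage => // m n _ _ /intr_inj.
exists (\sum_(z <- s) `|z|) => x.
have xs : [set` s] (cI x) by rewrite -sE; exists x.
by rewrite (big_rem _ xs) /= lerDl sumr_ge0.
Qed.

Theorem theorem6p4 (R : realType) (d : nat) (d_gt0 : (0 < d)%N)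
    (c : 'rV[R]_d -> R[i]) (c_conf : configuration c) (c_int : integral c)
    (f : 'rV[R]_d -> R[i]) (f_ann : annihilator c f) (f_neq0 : f <> cst 0)
    (f_int : integral f) (u : 'rV[R]_d) (u_supp : supp f u) :
  exists (m : nat) (v : 'I_m -> 'rV[R]_d),
    [/\ annihilator c (diff_prod v),
        forall i : 'I_m,
          exists2 ui : 'rV[R]_d, (supp f `\ u) ui & Qparallel (v i) (ui - u) &
        forall i j : 'I_m, i != j -> Qindep2 (v i) (v j)].
Proof.
have [cI cE] := integral_lift c_int; have [a fE] := integral_lift f_int.
have [M c_le] : exists M, forall x, `|cI x| <= M.
  by apply: configuration_bounded; rewrite -cE.
have [/finite_seqP[s' s'E] fc0] := f_ann.
have [s s_uniq sE] : exists2 s, uniq s & supp f = [set` s].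
  exists (undup s'); rewrite ?undup_uniq // s'E.
  by apply/seteqP; split=> v /=; rewrite mem_undup.
have ac0 : conv a id s cI = 0.
  apply/funext => x; have /(congr1 (@^~ x)) := fc0.
  rewrite (@pmul_seq _ _ _ _ s) // => [acx|v fv]; last first.
    by have : supp f v by []; rewrite sE.
  apply/eqP; rewrite convE -(intr_eq0 R[i]) rmorph_sum -[X in _ == X]acx.
  by apply/eqP/eq_bigr => v _; rewrite fE cE rmorphM.
have us : u \in s by have := u_supp; rewrite sE.
pose B := (\sum_(v <- s) `|a v|) * M.
(* Every prime up to [B] divides [r], hence does not divide 1 + r j. *)
pose r := (absz B)`!.
have dilate j : conv a (fun v => v *+ (1 + r * j)) s cI = 0.
  apply: (conv_dilate c_le) ac0 => // p pr_p p_dvd; rewrite ltNge -/B.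
  apply/negP => p_le; have : (p %| 1)%N.
    rewrite -(@dvdn_addl (r * j)) // dvdn_mulr // dvdn_fact //.
    by rewrite prime_gt0 //=; lia.
  by rewrite dvdn1 => /eqP p1; rewrite p1 in pr_p.
pose W v := (v - u) *+ r.
have Wc0 : Deltas [seq W v | v <- rem u s] cI = 0.
  apply: (@Deltas_eq0_of_progressions _ _ _ (a u) a (fun v => v - u) _ _ M) => //.
    by rewrite -(intr_eq0 R[i]); move: u_supp; rewrite /supp fE.
  (* Evaluating at x + k u with k = 1 + r j turns the term of [u] into [a u * cI x]; the term of [v]
     is then shifted by k (v - u) = (v - u) + j [W v]. *)
  move=> j x; have /(congr1 (@^~ (x + u *+ (1 + r * j)))) := dilate j.
  rewrite convE (big_rem _ us) /= addrK => acx; rewrite -[RHS]acx.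
  congr (_ + _); apply: eq_bigr => v _; congr (_ * cI _).
  by rewrite /W -mulrnA -mulrS add1n mulrnBl opprB addrA.
have W_supp w : w \in [seq W v | v <- rem u s] ->
    exists2 v, (supp f `\ u) v & Qparallel w (v - u).
  move=> /mapP[v]; rewrite mem_rem_uniq // => /andP[vu vs] ->.
  exists v; first by split; [rewrite sE | exact/eqP].
  by rewrite /W pmulrn; apply: Qparallel_mulz; rewrite -lt0n fact_gt0.
have W_neq0 : 0 \notin [seq W v | v <- rem u s].
  apply/mapP => -[v]; rewrite mem_rem_uniq // => /andP[vu _] /esym/eqP.
  rewrite /W -scaler_nat scaler_eq0 pnatr_eq0 subr_eq0 (negPf vu) orbF.
  by rewrite eqn0Ngt fact_gt0.
have [l [lc0 lW l_np]] := merge_parallel c_le W_neq0 Wc0.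
exists (size l), (fun i => l`_i); split.
- exact: annihilator_diff_prod cE lc0.
- move=> i; have [_ [w wW iw]] := lW _ (mem_nth 0 (ltn_ord i)).
  have [v fv wv] := W_supp w wW; exists v => //; exact: Qparallel_trans iw wv.
(* [pairwise] compares entries in list order only; the other order follows by symmetry. *)
have l_indep i j : (i < j < size l)%N -> Qindep2 l`_i l`_j.
  move=> /andP[ij jl]; have il := ltn_trans ij jl.
  apply: Qindep2_nparallel; [by case: (lW _ (mem_nth 0 il))| |].
    by case: (lW _ (mem_nth 0 jl)).
  have /negP np := pairwiseP 0 l_np i j il jl ij.
  by move=> par; apply: np; exact/asboolP.
move=> i j; rewrite neq_ltn => /orP[] lt_ij; first by apply: l_indep; rewrite lt_ij /=.
by apply: Qindep2_sym; apply: l_indep; rewrite lt_ij /=.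
Qed.
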